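(* For all integers $n,m,R$ with $1\le m\le n$ and $0\le R\le n$, there exist a circuit $\mathcal{C}\subset\mathbb{Z}^n$ with $m(\mathcal{C})=m$ and $\mathrm{rk}(\bar{\mathcal{C}})=R$, and a generic real polynomial system supported on $\mathcal{C}$ whose number $N$ of real solutions satisfies: $N=2^{\,n-R}(m+R+1)$ if $R\le m$, and $N=2^{\,n-R}(2m+1)$ if $R\ge m$.
   Context: A circuit is a set $\mathcal{C}\subset\mathbb{Z}^n$ of $n+2$ points whose affine span is $\mathbb{R}^n$; it contains a unique minimal affinely dependent subset, and $m(\mathcal{C})$ denotes the dimension of the affine span of that subset. The rank modulo $2$ of $\mathcal{C}$, $\mathrm{rk}(\bar{\mathcal{C}})$, is the rank over $\mathbb{Z}/2$ of the matrix whose columns are the reductions modulo $2$ of the vectors $w-w'$, $w\in\mathcal{C}$, for a fixed $w'\in\mathcal{C}$ (equivalently, after translating $\mathcal{C}$ so that $0\in\mathcal{C}$, of the nonzero elements of $\mathcal{C}$). A real polynomial system supported on $\mathcal{C}$ is a system of $n$ Laurent polynomial equations $F_1=\dots=F_n=0$ in $x=(x_1,\dots,x_n)$ with real coefficients, where each $F_j$ has support $\mathcal{C}$ (the set of exponent vectors of its monomials with nonzero coefficient). Such a system is generic if its number of solutions in $(\mathbb{C}^* )^n$ equals the normalized volume $v(\mathcal{C})$ of the convex hull of $\mathcal{C}$ (normalized so that $[0,1]^n$ has volume $n!$). Real solutions are solutions in $(\mathbb{R}^* )^n$. *)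

(* Defs.v *)
From HB Require Import structures.
From mathcomp Require Import all_boot all_order all_algebra.
From mathcomp Require Import Rstruct.
From mathcomp.real_closed Require Import complex.
From Stdlib Require Rdefinitions Rseries.

Set Implicit Arguments.
Unset Strict Implicit.
Unset Printing Implicit Defensive.

Import Order.TTheory GRing.Theory Num.Theory.
Local Open Scope ring_scope.

Notation R := Rdefinitions.R.
Notation Cx := (complex R).

Definition has_card (T : eqType) (A : T -> Prop) (k : nat) : Prop :=
  exists s : seq T, [/\ uniq s, size s = k & forall x, A x <-> x \in s].

Section Circuits.
Variable n : nat.
Variable pts : 'I_(n.+2) -> 'rV[int]_n.

Definition ptR (k : 'I_(n.+2)) : 'rV[R]_n := map_mx (fun z : int => z%:~R) (pts k).

Definition aff_dep (S : {set 'I_(n.+2)}) : Prop :=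
  exists lam : 'I_(n.+2) -> R,
    [/\ exists2 i, i \in S & lam i != 0,
        forall i, i \notin S -> lam i = 0,
        \sum_i lam i = 0 &
        \sum_i lam i *: ptR i = 0].

Definition minimal_aff_dep (S : {set 'I_(n.+2)}) : Prop :=
  aff_dep S /\ forall S' : {set 'I_(n.+2)}, S' \proper S -> ~ aff_dep S'.

Definition aff_dim (S : {set 'I_(n.+2)}) : nat :=
  match [pick i in S] with
  | Some i0 => \rank (\matrix_(k < n.+2) (if k \in S then ptR k - ptR i0 else 0))
  | None => 0%N
  end.

Definition is_circuit : Prop := injective pts /\ aff_dim setT = n.

(** m(C) = m : the (unique) minimal affinely dependent subset has affine span
    of dimension m. *)
Definition circuit_m (m : nat) : Prop :=
  (exists S, minimal_aff_dep S) /\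
  forall S, minimal_aff_dep S -> aff_dim S = m.

Definition rank_mod2 : nat :=
  \rank (\matrix_(k < n.+2, i < n) (((pts k ord0 i - pts ord0 ord0 i)%:~R) : 'F_2)).

(** Normalized volume of the convex hull, via Jordan content:
    (#{p in Z^n : p/k in conv C}) / k^n --> vol(conv C) = v / n!. *)
Definition in_conv (x : 'rV[R]_n) : Prop :=
  exists lam : 'I_(n.+2) -> R,
    [/\ forall i, 0 <= lam i, \sum_i lam i = 1 & x = \sum_i lam i *: ptR i].

Definition normalized_volume_is (v : R) : Prop :=
  exists cnt : nat -> nat,
    (forall k : nat,
        has_card (fun p : 'rV[int]_n =>
                    in_conv (((k.+1)%:R)^-1 *: map_mx (fun z : int => z%:~R) p))
                 (cnt k)) /\
    Rseries.Un_cv (fun k : nat => (cnt k)%:R / ((k.+1)%:R ^+ n)) (v / (n`!)%:R).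

Definition eval_lpoly (F : fieldType) (f : R -> F) (c : 'I_(n.+2) -> R)
    (z : 'rV[F]_n) : F :=
  \sum_(k < n.+2) f (c k) * \prod_(i < n) (z ord0 i) ^ (pts k ord0 i).

Definition supported_on (c : 'I_n -> 'I_(n.+2) -> R) : Prop :=
  forall j k, c j k != 0.

Definition complex_solution (c : 'I_n -> 'I_(n.+2) -> R) (z : 'rV[Cx]_n) : Prop :=
  (forall i, z ord0 i != 0) /\
  forall j, eval_lpoly (fun r : R => (r%:C)%C) (c j) z = 0.

Definition real_solution (c : 'I_n -> 'I_(n.+2) -> R) (x : 'rV[R]_n) : Prop :=
  (forall i, x ord0 i != 0) /\
  forall j, eval_lpoly id (c j) x = 0.

Definition generic_system (c : 'I_n -> 'I_(n.+2) -> R) : Prop :=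
  exists N : nat, has_card (complex_solution c) N /\ normalized_volume_is N%:R.

End Circuits.

(* Main.v *)
Require Import Defs.
From HB Require Import structures.
From mathcomp Require Import all_boot all_order all_algebra.
From mathcomp Require Import Rstruct.
From mathcomp.real_closed Require Import complex.
From mathcomp Require Import polyrcf ring lra zify.
From mathcomp Require boolp.

Set Implicit Arguments.
Unset Strict Implicit.
Unset Printing Implicit Defensive.

Import Order.TTheory GRing.Theory Num.Theory.

Local Open Scope ring_scope.

(** With [s = m - R] (truncated) and [r = min(m, R)], take the points [0],
    [a_i e_i] and [w = sum_i a_i b_i e_i], where [a_i = 1] for [R] of the
    indices and [a_i = 2] for the others, and where the [b_i] are [+2] or [-2]
    for [i < m] and [0] for [i >= m].  Their only affine relation is
    [w = sum_i b_i (a_i e_i) + (1 - sum_i b_i) 0].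
    The system is equivalent to [x_i^(a_i) = 1 + t_i y] with [y = x^w], so the
    solutions are governed by the equation [y = prod_i (1 + t_i y)^(b_i)].
    Clearing denominators, it reads [D = U] for two polynomials starting from
    [(y, 1)] and built factor by factor: the first [s] factors [(1 + t y)^2]
    multiply the side of smaller degree, with [t > 0] so small that the earlier
    sign alternations of [D - U] survive and one more appears near infinity; the
    next [r] factors have [t < 0] and multiply the side of larger degree,
    which creates two further roots around the double root [-1/t].  In the end
    [D - U] has degree [s + 2r + 1] and only simple positive roots, at which
    every [1 + t_i y] with [a_i = 2] is positive.  Hence all complex solutions
    are real, and there are [2^(n-R) (m + min(m, R) + 1)] of them.

    The volume is obtained by counting lattice points.  Up to bounded shifts,
    the lattice points of the [k]-th dilate that lie in one coset of the lattice
    spanned by the [a_i e_i] are the combinations of the [n + 2] points with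
    coefficients in [N] of sum [k], counted modulo the affine relation.
    There are [C(k+n+1, n+1) - C(k-v+n+1, n+1)] of these, where
    [v = s + 2r + 1] is the sum of the positive coefficients of the relation. *)

(** * Polynomials with many positive roots *)

Section RealRoots.
Variable K : rcfType.
Implicit Types (p q f D U : {poly K}) (d : nat) (x y e : K).

(** The sign is normalized so that [f] is positive at the last of the [d + 1] points; each of the
    [d] gaps then contains a root. *)
Definition alternates f d : Prop := exists ys : nat -> K,
  [/\ 0 < ys 0%N, forall i, (i < d)%N -> ys i < ys i.+1 &
      forall i, (i <= d)%N -> 0 < (-1) ^+ (d + i) * f.[ys i]].

Lemma alternates_snoc f d (ys : nat -> K) y :
  0 < ys 0%N -> (forall i, (i < d)%N -> ys i < ys i.+1) ->
  (forall i, (i <= d)%N -> 0 < (-1) ^+ (d.+1 + i) * f.[ys i]) ->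
  ys d < y -> 0 < f.[y] -> alternates f d.+1.
Proof.
move=> ys0 ysi sg ydy fy; exists (fun i => if (i <= d)%N then ys i else y).
split=> // i.
  rewrite ltnS => id; rewrite id; case: ltnP => [/ysi //|di].
  by have -> : i = d by apply/eqP; rewrite eqn_leq id di.
rewrite leq_eqVlt => /predU1P[->|]; last first.
    by rewrite ltnS => id; rewrite id; apply: sg.
by rewrite ltnn addnn -mul2n exprM sqrrN expr1n expr1n mul1r.
Qed.

Lemma alternates_roots f d : alternates f d ->
  exists rts : seq K, [/\ uniq rts, size rts = d, all (root f) rts &
    all (> 0) rts].
Proof.
case=> ys [ys0 ysi sg].
have pos i : (i <= d)%N -> 0 < ys i.
  by elim: i => // i IH id; apply: lt_trans (IH (ltnW id)) (ysi _ id).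
suff: forall k, (k <= d)%N -> exists rts : seq K,
    [/\ uniq rts, size rts = k, all (root f) rts, all (> 0) rts
      & all (< ys k) rts].
  by move=> /(_ d (leqnn _))[rts [? ? ? ? _]]; exists rts.
elim=> [|k IH] kd; first by exists [::].
have [rts [urts srts rrts prts ltrts]] := IH (ltnW kd).
have [z /andP[zl zr] rz]: exists2 z, ys k < z < ys k.+1 & root f z.
  have sk := sg k (ltnW kd); have := sg k.+1 kd.
  set c := (-1) ^+ (d + k) in sk; rewrite addnS exprS -/c mulN1r mulNr => sk1.
  have [|z /andP[zl zr]] := poly_ivt (p := - (c *: f)) (ltW (ysi _ kd)).
    by rewrite !hornerN !hornerZ oppr_le0 -mulNr ltW //= mulNr ltW.
  rewrite rootE hornerN hornerZ oppr_eq0 mulf_eq0 signr_eq0 /= => fz.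
  exists z => //; rewrite !lt_neqAle zl zr !andbT.
  apply/andP; split; apply/eqP => zE.
    by move: sk; rewrite zE (eqP fz) mulr0 ltxx.
  by move: sk1; rewrite -zE (eqP fz) mulr0 oppr0 ltxx.
exists (z :: rts); split=> /=.
- rewrite urts andbT; apply/negP => /(allP ltrts) zk.
  by move: (lt_trans zl zk); rewrite ltxx.
- by rewrite srts.
- by rewrite rz.
- by rewrite prts (lt_trans (pos _ (ltnW kd)) zl).
- by rewrite zr; apply: sub_all ltrts => x /lt_trans; apply; apply: ysi.
Qed.

(** The expression is a polynomial in [e] with value [u + v] at 0, so continuity at 0 suffices. *)
Lemma perturb_gt0 (u v y : K) : 0 < u + v ->
  exists2 d, 0 < d & forall e, `|e| < d -> 0 < u + v * (1 + e * y) ^+ 2.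
Proof.
move=> uv; pose p := u%:P + v *: (1 + y *: 'X) ^+ 2.
have pE e : p.[e] = u + v * (1 + e * y) ^+ 2.
  by rewrite !hornerE (mulrC y).
have [d d0 dP] := poly_cont (0 : K) p uv; exists d => // e ed.
have := dP e; rewrite subr0 ed => /(_ isT).
rewrite !pE mul0r addr0 expr1n mulr1 => /ltr_normlP[+ _].
by rewrite opprB; lra.
Qed.

Lemma perturb_all d (P : nat -> K -> Prop) :
  (forall i, (i <= d)%N -> exists2 c, 0 < c & forall e, `|e| < c -> P i e) ->
  exists2 c, 0 < c & forall e, `|e| < c -> forall i, (i <= d)%N -> P i e.
Proof.
elim: d => [|d IH] h.
  have [c c0 cP] := h 0%N isT; exists c => // e ec i.
  by rewrite leqn0 => /eqP ->; apply: cP.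
have [|c c0 cP] := IH; first by move=> i id; apply: h; apply: leqW.
have [c' c0' cP'] := h d.+1 (leqnn _).
exists (Num.min c c'); first by rewrite lt_min c0.
move=> e; rewrite lt_min => /andP[ec ec'] i; rewrite leq_eqVlt => /predU1P[->|].
  exact: cP'.
by rewrite ltnS; apply: cP.
Qed.

Definition sqlin (t : K) : {poly K} := (1 + t *: 'X) ^+ 2.

Lemma horner_sqlin t y : (sqlin t).[y] = (1 + t * y) ^+ 2.
Proof. by rewrite /sqlin !hornerE. Qed.

Lemma size_lin t : t != 0 -> size (1 + t *: 'X : {poly K}) = 2%N.
Proof.
move=> t0; rewrite addrC size_polyDl ?size_scale ?size_polyX //.
by rewrite size_poly1.
Qed.

Lemma lead_coef_lin t : t != 0 -> lead_coef (1 + t *: 'X : {poly K}) = t.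
Proof.
move=> t0; rewrite addrC lead_coefDl ?lead_coefZ ?lead_coefX ?mulr1 //.
by rewrite size_scale // size_polyX size_poly1.
Qed.

Lemma size_sqlin t : t != 0 -> size (sqlin t) = 3%N.
Proof.
by move=> t0; rewrite /sqlin expr2 size_mul -?size_poly_eq0 ?size_lin.
Qed.

Lemma lead_coef_sqlin t : t != 0 -> 0 < lead_coef (sqlin t).
Proof. by move=> t0; rewrite lead_coef_exp lead_coef_lin // exprn_even_gt0. Qed.

Lemma size_mul_sqlin p t : t != 0 -> 0 < lead_coef p ->
  size (p * sqlin t) = (size p).+2.
Proof.
move=> t0 lp; rewrite size_mul -?size_poly_eq0 ?size_sqlin // ?addnS ?addn0 //.
by rewrite size_poly_eq0 -lead_coef_eq0 gt_eqF.
Qed.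

Lemma lead_coef_mul_sqlin p t : t != 0 -> 0 < lead_coef p ->
  0 < lead_coef (p * sqlin t).
Proof. by move=> t0 lp; rewrite lead_coefM mulr_gt0 ?lead_coef_sqlin. Qed.

(** Invariant of the construction: the [d] sign changes account for all roots of [D - U], which has
    degree [d]. The leading coefficients control signs near infinity, also after an exchange of
    sides; positivity of [U] gives a negative value at the double root of a new factor. *)
Definition state D U d : Prop :=
  [/\ size D = d.+1, (size U <= d)%N, 0 < lead_coef D, 0 < lead_coef U &
      alternates (D - U) d /\ forall y, 0 < y -> 0 < U.[y]].

Lemma lead_coef_state D U d : state D U d ->
  lead_coef (D - U) = lead_coef D /\ size (D - U) = d.+1.
Proof.
case=> sD sU _ _ _; rewrite lead_coefDl ?size_polyDl ?size_polyN //.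
all: by rewrite sD ltnS.
Qed.

Lemma state_far D U d y : size D = d.+1 -> (size U <= d)%N -> 0 < lead_coef D ->
  exists2 z, y < z & 0 < (D - U).[z].
Proof.
move=> sD sU lD.
have lE : lead_coef (D - U) = lead_coef D.
  by rewrite lead_coefDl // size_polyN sD ltnS.
have [|n nP] := poly_pinfty_gt_lc (p := D - U); first by rewrite lE.
exists (Num.max n (y + 1)); first by rewrite lt_max ltrDl ltr01 orbT.
by apply: lt_le_trans (nP _ _); rewrite ?lE // le_max lexx.
Qed.

(** For small [t] the signs of [U - D] at the old points survive, the last one being negative. As
    [U] has degree [d - 1], the new product has degree [d + 1] and dominates [D] far out, which
    gives one more sign change. *)
Lemma state_swap D U d : state D U d -> size U = d ->
  (forall y, 0 < y -> 0 < D.[y]) ->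
  exists2 t, 0 < t & state (U * sqlin t) D d.+1.
Proof.
case=> sD sU lD lU [[ys [ys0 ysi sg]] Upos] sSd Dpos.
have [|c c0 cP] := @perturb_all d (fun i e =>
    0 < (-1) ^+ (d.+1 + i) * (U * sqlin e - D).[ys i]).
  move=> i id; set u := (-1) ^+ (d.+1 + i).
  have [|c c0 cP] := @perturb_gt0 (- u * D.[ys i]) (u * U.[ys i]) (ys i).
    have := sg i id; rewrite !hornerE /u addSn exprS mulN1r; lra.
  exists c => // e /cP h; rewrite hornerD hornerN hornerM horner_sqlin.
  by apply: etrans h; congr (0 < _); ring.
have c20 : 0 < c / 2 by rewrite divr_gt0.
exists (c / 2) => //.
have cn0 : c / 2 != 0 by rewrite gt_eqF.
have sz : size (U * sqlin (c / 2)) = d.+2 by rewrite size_mul_sqlin // sSd.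
have lc := lead_coef_mul_sqlin cn0 lU.
split=> //; first by rewrite sD.
split=> //.
have [|z zy fz] := @state_far (U * sqlin (c / 2)) D d.+1 (ys d) sz _ lc.
  by rewrite sD.
apply: (alternates_snoc ys0 ysi _ zy fz) => i id; apply: cP => //.
by rewrite gtr0_norm //; lra.
Qed.

(** A negative [t] close to 0 preserves the old signs. With [-1/t] beyond both the last old point
    and [c^-1], the difference is [- U] there and positive further out: two new sign changes. *)
Lemma state_double D U d : state D U d ->
  exists2 t, t < 0 & state (D * sqlin t) U d.+2.
Proof.
case=> sD sU lD lU [[ys [ys0 ysi sg]] Upos].
have [|c c0 cP] := @perturb_all d (fun i e =>
    0 < (-1) ^+ (d + i) * (D * sqlin e - U).[ys i]).
  move=> i id; set u := (-1) ^+ (d + i).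
  have [|c c0 cP] := @perturb_gt0 (- u * U.[ys i]) (u * D.[ys i]) (ys i).
    have := sg i id; rewrite !hornerE -/u; lra.
  exists c => // e /cP h; rewrite hornerD hornerN hornerM horner_sqlin.
  by apply: etrans h; congr (0 < _); ring.
have pos i : (i <= d)%N -> 0 < ys i.
  by elim: i => // i IH id; apply: lt_trans (IH (ltnW id)) (ysi _ id).
(* [y = -1/t] is the double root of the new factor; there [D * sqlin t - U < 0] *)
pose y := Num.max (ys d) c^-1 + 1.
have y0 : 0 < y by rewrite ltr_wpDl // le_max (ltW (pos d _)).
have yd : ys d < y.
  by apply: (@le_lt_trans _ _ (Num.max (ys d) c^-1)); rewrite ?le_max ?lexx ?ltrDl.
have yc : c^-1 < y.
  apply: (@le_lt_trans _ _ (Num.max (ys d) c^-1)); last by rewrite ltrDl.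
  by rewrite le_max lexx orbT.
have t0 : - y^-1 < 0 by rewrite oppr_lt0 invr_gt0.
exists (- y^-1) => //.
have tn0 : - y^-1 != 0 by rewrite lt_eqF.
have sz : size (D * sqlin (- y^-1)) = d.+3 by rewrite size_mul_sqlin // sD.
have lc := lead_coef_mul_sqlin tn0 lD.
have sS2 : (size U <= d.+2)%N by rewrite (leq_trans sU) // leqW.
split=> //; split=> //.
have tc : `|- y^-1| < c.
  rewrite normrN gtr0_norm ?invr_gt0 // -[ltRHS]invrK ltf_pV2 // posrE ?invr_gt0 //.
have [z zy fz] := state_far y sz sS2 lc.
pose ys' i := if (i <= d)%N then ys i else y.
apply: (@alternates_snoc _ d.+1 ys' z) => //.
- move=> i; rewrite ltnS /ys' => id; rewrite id; case: ltnP => [/ysi //|di].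
  by have -> : i = d by apply/eqP; rewrite eqn_leq id di.
- move=> i; rewrite leq_eqVlt /ys' => /predU1P[->|].
    rewrite ltnn addSn addnn exprS -mul2n exprM sqrrN expr1n expr1n mulr1 mulN1r.
    rewrite hornerD hornerN hornerM horner_sqlin mulNr mulVf ?gt_eqF // subrr.
    rewrite expr0n mulr0.
    by rewrite sub0r opprK Upos.
  rewrite ltnS => id; rewrite id 2!addSn !exprS !mulN1r opprK.
  exact: cP.
- by rewrite /ys' ltnn.
Qed.

(* The first component is the side of larger degree. *)
Fixpoint sides s (t : nat -> K) j : {poly K} * {poly K} :=
  if j is i.+1 then
    let: (D, U) := sides s t i in
    if (i < s)%N then (U * sqlin (t i), D) else (D * sqlin (t i), U)
  else ('X, 1).

Lemma eq_sides s t t' j : (forall i, (i < j)%N -> t i = t' i) ->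
  sides s t j = sides s t' j.
Proof.
elim: j => //= j IH h; rewrite IH ?(h j) // => i ij.
by apply: h; rewrite ltnS ltnW.
Qed.

(** The degrees differ by exactly one, as [state_swap] requires, and positive [t i] keep both sides
    positive on the positive axis, so the roles can be exchanged again. *)
Lemma state_sides_swap s j : (j <= s)%N -> exists t : nat -> K,
  let D := (sides s t j).1 in let U := (sides s t j).2 in
  [/\ forall i, 0 < t i, state D U j.+1, size U = j.+1 &
      forall y, 0 < y -> 0 < D.[y]].
Proof.
elim: j => [_|j IH js].
  exists (fun=> 1); split=> //=; rewrite ?size_poly1 //; last first.
    by move=> y; rewrite hornerX.
  split; rewrite ?size_polyX ?size_poly1 ?lead_coefX ?lead_coef1 //.
  split; last by move=> y _; rewrite hornerC.
  (* The points 1/2 and 2 enclose the root 1 of ['X - 1]. *)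
  exists (fun i => if i == 0%N then 2^-1 else 2).
  split=> /=; first lra; first by case=> //=; lra.
  by case=> [|[|]] // _; rewrite /= !hornerE ?expr1 /=; lra.
have [t /= [tpos st sU Dpos]] := IH (ltnW js).
have [e e0 st'] := state_swap st sU Dpos.
pose t' i := if (i == j)%N then e else t i.
have E : sides s t' j = sides s t j.
  by apply: eq_sides => i ij; rewrite /t' (ltn_eqF ij).
exists t'; rewrite /= E; move: st sU Dpos st'.
case: (sides s t j) => D U /= st sU Dpos st'; rewrite js /=.
split=> //.
- by move=> i; rewrite /t'; case: ifP.
- by rewrite /t' eqxx.
- by case: st.
- move=> y y0; rewrite hornerM horner_sqlin /t' eqxx.
  case: st => _ _ _ _ [_ Upos].
  by rewrite mulr_gt0 ?Upos // exprn_gt0 // addr_gt0 // mulr_gt0.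
Qed.

(** The [r] doubling steps follow the exchanges. The [t i] with [i >= s + r] are kept positive for
    the equations in the coordinates beyond the first [m]. *)
Lemma state_sides s r : exists t : nat -> K,
  let D := (sides s t (s + r)).1 in let U := (sides s t (s + r)).2 in
  [/\ forall i, (s <= i < s + r)%N = (t i < 0), forall i, t i != 0 &
      state D U (s + 2 * r).+1].
Proof.
elim: r => [|r [t /= [tneg tn0 st]]].
  have [t /= [tpos st _ _]] := state_sides_swap (leqnn s).
  exists t; rewrite /= !addn0; split=> // i.
    rewrite (lt_gtF (tpos i)); by rewrite leqNgt andNb.
  by rewrite gt_eqF.
have [e e0 st'] := state_double st.
pose t' i := if (i == s + r)%N then e else t i.
have E : sides s t' (s + r) = sides s t (s + r).
  by apply: eq_sides => i ij; rewrite /t' (ltn_eqF ij).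
exists t'; rewrite addnS /= E; move: st'.
case: (sides s t (s + r)) => D U /= st'; rewrite ltnNge leq_addr /=.
split.
- move=> i; rewrite /t'; case: eqP => [->|ne]; first by rewrite leq_addr e0 ltnS leqnn.
  rewrite -tneg ltnS (leq_eqVlt i); by move/eqP/negPf: ne => ->.
- by move=> i; rewrite /t'; case: ifP => // _; rewrite lt_eqF.
- have -> : (s + 2 * r.+1).+1 = (s + 2 * r).+3 by rewrite mulnS; lia.
  by rewrite /t' eqxx.
Qed.

(** The roots found are as many as the degree of [D - U], which thus splits into distinct linear
    factors; no further root can appear over a larger field. *)
Lemma sides_roots s r : exists (t : nat -> K) (rts : seq K),
  let D := (sides s t (s + r)).1 in let U := (sides s t (s + r)).2 in
  [/\ forall i, (s <= i < s + r)%N = (t i < 0), forall i, t i != 0,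
      uniq rts /\ size rts = (s + 2 * r).+1,
      forall y, y \in rts -> 0 < y /\ 0 < U.[y] &
      exists2 c : K, c != 0 & D - U = c *: \prod_(z <- rts) ('X - z%:P)].
Proof.
have [t /= [tneg tn0 st]] := state_sides s r.
have [lE sE] := lead_coef_state st.
have [_ _ lD _ [alt Upos]] := st.
have [rts [urts srts rrts prts]] := alternates_roots alt.
exists t, rts; split=> //.
  by move=> y /(allP prts) y0; split=> //; apply: Upos.
eexists; last first.
  apply: all_roots_prod_XsubC => //; first by rewrite sE srts.
  by rewrite uniq_rootsE.
by rewrite lE gt_eqF.
Qed.
End RealRoots.

(* [b_i], in the notation of the introduction, for [i < m]. *)
Definition sideexp (s i : nat) : int :=
  if (i < s)%N then 2 * (-1) ^+ i else - (2 * (-1) ^+ s).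

(** * The polynomial equation as an equation between powers *)

Section Sides.
Variables (K : rcfType) (F : fieldType) (phi : {rmorphism K -> F}).
Variables (s : nat) (t : nat -> K).

Lemma horner_map_sqlin e (y : F) :
  (map_poly phi (sqlin e)).[y] = (1 + phi e * y) ^+ 2.
Proof.
by rewrite /sqlin rmorphXn /= rmorphD /= rmorph1 map_polyZ map_polyX !hornerE.
Qed.

(** Each exchange of sides inverts [U / D], and the exponent [(-1) ^+ minn j s] undoes this. The
    quotient starts as [y^-1], and every squared factor enters with exponent [sideexp s i]. *)
Lemma sides_ratio j (y : F) :
  y != 0 -> (forall i, (i < j)%N -> 1 + phi (t i) * y != 0) ->
  let: (D, U) := sides s t j in
  [/\ (map_poly phi D).[y] != 0, (map_poly phi U).[y] != 0 &
    ((map_poly phi U).[y] / (map_poly phi D).[y]) ^ ((-1) ^+ minn j s : int) =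
      y^-1 * \prod_(i < j) (1 + phi (t i) * y) ^ sideexp s i].
Proof.
move=> y0; elim: j => [_|j IH ne].
  rewrite /= map_polyX rmorph1 hornerX hornerC oner_eq0 min0n expr0 expr1z div1r.
  by rewrite big_ord0 mulr1.
have {IH} := IH (fun i ij => ne i (leqW ij)).
have := ne j (leqnn _); set q := 1 + _ => q0 {ne}.
rewrite big_ord_recr /= mulrA; case: (sides s t j) => D U [D0 U0 <-].
set u := (map_poly phi U).[y] in U0 *; set v := (map_poly phi D).[y] in D0 *; rewrite -/q.
have q20 : q ^+ 2 != 0 by rewrite expf_neq0.
rewrite /sideexp; case: ltnP => js.
  rewrite rmorphM /= hornerM horner_map_sqlin -/u -/v -/q mulf_neq0 //; split=> //.
  rewrite (minn_idPl js) [(-1) ^+ j.+1]exprS mulN1r -exprz_inv invf_div.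
  by rewrite mulrAC expfzMl -[in RHS]exprz_exp.
rewrite rmorphM /= hornerM horner_map_sqlin -/u -/v -/q mulf_neq0 //; split=> //.
rewrite (minn_idPr (leqW js)) invfM mulrA expfzMl; congr (_ * _).
by rewrite exprz_inv -mulrN -exprz_exp.
Qed.

Lemma sides_neq0 j (y : K) : let: (D, U) := sides s t j in
  D.[y] != 0 -> U.[y] != 0 -> forall i, (i < j)%N -> 1 + t i * y != 0.
Proof.
elim: j => //= j; case: (sides s t j) => D U IH.
have sq (p : {poly K}) : (p * sqlin (t j)).[y] != 0 ->
    p.[y] != 0 /\ 1 + t j * y != 0.
  by rewrite hornerM horner_sqlin mulf_eq0 sqrf_eq0 negb_or => /andP.
have lastP i : (i < j.+1)%N -> i = j \/ (i < j)%N.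
  by rewrite ltnS leq_eqVlt => /predU1P.
by case: ifP => _ /sq[p0 q0] p0' i /lastP[->//|]; apply: IH.
Qed.

Lemma sides_eqE n j (y : F) : (j <= n)%N ->
  y != 0 -> (forall i, (i < j)%N -> 1 + phi (t i) * y != 0) ->
  root (map_poly phi ((sides s t j).1 - (sides s t j).2)) y =
  (y == \prod_(i < n) (1 + phi (t i) * y) ^ (if (i < j)%N then sideexp s i else 0)).
Proof.
move=> jn y0 ne; have := sides_ratio y0 ne; case: (sides s t j) => D U /= [D0 U0].
set e := _ ^+ _; set P := \prod_(i < j) _; set Q := \prod_(i < n) _.
have -> : Q = P.
  rewrite /P (big_ord_widen n (fun i => (1 + phi (t i) * y) ^ sideexp s i) jn).
  by rewrite big_mkcond; apply: eq_bigr => i _; case: ifP.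
move=> ratioE; rewrite rmorphB rootE hornerD hornerN subr_eq0.
have -> : (y == P) = (y^-1 * P == 1).
  by rewrite mulrC -[RHS](inj_eq (mulIf y0)) divfK // mul1r eq_sym.
rewrite -ratioE; apply/eqP/eqP => [->|]; first by rewrite divff // exp1rz.
(* The exponent [e] is 1 or -1; either way the quotient [U / D] is 1. *)
rewrite /e -signr_odd; case: (odd _); rewrite ?expr0 ?expr1.
  by rewrite -exprz_inv expr1z invf_div => /divr1_eq.
by rewrite expr1z => /divr1_eq.
Qed.
End Sides.

(** * The circuit and the system *)

(** Numbering of the points: the origin comes first, then the [n] axis points, and [w] last, at
    [ord_max]. *)
Definition axis n (i : 'I_n) : 'I_n.+2 := lift ord0 (lift ord_max i).

Lemma val_axis n (i : 'I_n) : axis i = i.+1 :> nat.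
Proof. by rewrite /= /bump (leqNgt n) ltn_ord. Qed.

Lemma axis_inj n : injective (@axis n).
Proof. by move=> i j /lift_inj/lift_inj. Qed.

Lemma axis_neq0 n (i : 'I_n) : (axis i == ord0) = false.
Proof. by rewrite -val_eqE. Qed.

Lemma axis_neqmax n (i : 'I_n) : (axis i == ord_max) = false.
Proof. by rewrite -val_eqE [val (axis i)]val_axis /= eqSS ltn_eqF. Qed.

Lemma max_neq0 n : (ord_max == ord0 :> 'I_n.+2) = false.
Proof. by rewrite -val_eqE. Qed.

Lemma big_axis n (M : Type) (idx : M) (op : Monoid.com_law idx) (G : 'I_n.+2 -> M) :
  \big[op/idx]_k G k =
  op (G ord0) (op (\big[op/idx]_i G (axis i)) (G ord_max)).
Proof.
rewrite big_ord_recl big_ord_recr /=; congr (op _ (op _ (G _))).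
  apply: eq_bigr => i _; congr (G _); apply/val_inj.
  by rewrite [RHS]val_axis.
exact/val_inj.
Qed.

Lemma ord_axisP n (P : 'I_n.+2 -> Prop) :
  P ord0 -> (forall i, P (axis i)) -> P ord_max -> forall k, P k.
Proof.
move=> P0 Pa Pm k; case: (unliftP ord0 k) => [j ->|->] //.
case: (unliftP ord_max j) => [i ->|->]; first exact: Pa.
by have -> : lift ord0 ord_max = ord_max :> 'I_n.+2 by apply: val_inj.
Qed.

Section Points.
Variables (n : nat) (T : {set 'I_n}) (b : 'I_n -> int).

(* [T] is the set of the indices with [a_i = 2]. *)
Definition edge (i : 'I_n) : nat := (i \in T).+1.

Definition cpts (k : 'I_n.+2) : 'rV[int]_n :=
  \row_i ((k == axis i)%:R * (edge i)%:Z + (k == ord_max)%:R * ((edge i)%:Z * b i)).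

Lemma cpts0 : cpts ord0 = 0.
Proof. by apply/rowP => i; rewrite !mxE eq_sym axis_neq0 eq_sym max_neq0 !mul0r. Qed.

Lemma cpts_axis i j : cpts (axis i) 0 j = if i == j then (edge i)%:Z else 0.
Proof.
rewrite !mxE axis_neqmax mul0r addr0 (inj_eq (@axis_inj n)).
by case: eqP => [->|]; rewrite ?mul1r ?mul0r.
Qed.

Lemma cpts_max j : cpts ord_max 0 j = (edge j)%:Z * b j.
Proof. by rewrite !mxE eqxx eq_sym axis_neqmax mul0r mul1r add0r. Qed.

Definition wmon (F : fieldType) (z : 'rV[F]_n) : F :=
  \prod_i z 0 i ^ ((edge i)%:Z * b i).

Lemma eval_cpts (F : fieldType) (phi : {rmorphism R -> F}) c (z : 'rV[F]_n) :
  eval_lpoly cpts phi c z =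
  phi (c ord0) + (\sum_i phi (c (axis i)) * z 0 i ^+ edge i
                  + phi (c ord_max) * wmon z).
Proof.
rewrite /eval_lpoly big_axis cpts0 big1 ?mulr1; last first.
  by move=> i _; rewrite !mxE expr0z.
congr (_ + (_ + _ * _)); last by apply: eq_bigr => i _; rewrite cpts_max.
apply: eq_bigr => i _; congr (_ * _).
rewrite (bigD1 i) //= big1 ?mulr1 => [|j ji]; rewrite cpts_axis ?eqxx //.
by rewrite eq_sym (negPf ji) expr0z.
Qed.

(* The equations [x_i^(a_i) - 1 - t_i y = 0] mixed by the matrix [1 + g J], [J] the
   all-ones matrix, so that every monomial occurs in every equation. *)
Definition csys (g : R) (t : nat -> R) (j : 'I_n) (k : 'I_n.+2) : R :=
  if k == ord0 then - (1 + g * n%:R)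
  else if k == ord_max then - (t j + g * \sum_(i < n) t i)
  else g + (k == axis j)%:R.

(** With defects [e i], equation [j] reads [e j + g * \sum_i e i = 0]. Summing over [j] gives
    [(1 + g n) * \sum_i e i = 0], so the sum vanishes and then each defect does. *)
Lemma csys_solve (F : fieldType) (phi : {rmorphism R -> F}) g t (z : 'rV[F]_n) :
  0 < g ->
  (forall j, eval_lpoly cpts phi (csys g t j) z = 0) <->
  (forall i, z 0 i ^+ edge i = 1 + phi (t i) * wmon z).
Proof.
move=> g0; pose e i := z 0 i ^+ edge i - (1 + phi (t i) * wmon z).
have evalE j : eval_lpoly cpts phi (csys g t j) z = e j + phi g * \sum_i e i.
  rewrite eval_cpts /csys eqxx max_neq0 eqxx.
  under eq_bigr => i _ do rewrite axis_neq0 axis_neqmax (inj_eq (@axis_inj n))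
    rmorphD mulrDl.
  rewrite big_split /= [X in _ + (_ + X + _)](bigD1 j) //= eqxx rmorph1 mul1r.
  rewrite [X in _ + (_ + (_ + X) + _)]big1 ?addr0; last first.
    by move=> i /negPf->; rewrite rmorph0 mul0r.
  rewrite sumrB big_split /= -mulr_sumr -mulr_suml sumr_const card_ord.
  rewrite /e !rmorphN !rmorphD !rmorphM /= rmorph1 rmorph_nat rmorph_sum /=.
  ring.
have n0 : 1 + phi g * n%:R != 0.
  rewrite -(rmorph_nat phi) -rmorphM -(rmorph1 phi) -rmorphD fmorph_eq0.
  by rewrite gt_eqF // ltr_wpDr // mulr_ge0 // ltW.
split=> [h i|h j].
  have se : \sum_i e i = 0.
    have : \sum_j (e j + phi g * \sum_i e i) = 0.
      by rewrite big1 // => j _; rewrite -evalE.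
    rewrite big_split /= sumr_const card_ord -mulr_natr.
    rewrite (_ : _ + _ = (1 + phi g * n%:R) * \sum_i e i); last by ring.
    by move/eqP; rewrite mulf_eq0 (negPf n0) => /eqP.
  have := evalE i; rewrite h se mulr0 addr0 => /esym/eqP.
  by rewrite subr_eq0 => /eqP.
have e0 i : e i = 0 by apply/eqP; rewrite subr_eq0 h.
by rewrite evalE e0 big1 ?mulr0 ?addr0.
Qed.
End Points.

(** * Solutions over the reals and over extension fields *)

Section Solutions.
Variables (n s r : nat) (T : {set 'I_n}) (t : nat -> R) (rts : seq R).
Hypothesis srn : (s + r <= n)%N.
Hypothesis tneg : forall i, (s <= i < s + r)%N = (t i < 0).
Hypothesis T_tpos : forall i, i \in T -> 0 < t i.
Hypothesis rts_pos : forall y, y \in rts ->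
  0 < y /\ 0 < (sides s t (s + r)).2.[y].
Variable c : R.
Hypothesis c_neq0 : c != 0.
Hypothesis rtsE : (sides s t (s + r)).1 - (sides s t (s + r)).2 =
  c *: \prod_(z <- rts) ('X - z%:P).

Definition cexp (i : 'I_n) : int := if (i < s + r)%N then sideexp s i else 0.

(** [sg] is the set of coordinates in [T] where the negative square root is taken. *)
Definition sol (y : R) (sg : {set 'I_n}) : 'rV[R]_n :=
  \row_i (if i \in T then (-1) ^+ (i \in sg) * Num.sqrt (1 + t i * y)
          else 1 + t i * y).

(** At a root both sides equal the same positive number, so none of their factors vanishes; for
    [i >= s + r] the term is positive. *)
Lemma rts_lin_neq0 y i : y \in rts -> 1 + t i * y != 0.
Proof.
move=> yr; have [y0 Uy] := rts_pos yr.
have Dy : (sides s t (s + r)).1.[y] = (sides s t (s + r)).2.[y].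
  apply/eqP; rewrite -subr_eq0 -hornerN -hornerD rtsE hornerZ.
  suff : root (\prod_(z <- rts) ('X - z%:P)) y by rewrite rootE => /eqP->; rewrite mulr0.
  by rewrite root_prod_XsubC.
have [isr|] := boolP (i < s + r)%N.
  have := @sides_neq0 _ s t (s + r) y; move: Dy Uy.
  by case: (sides _ _ _) => D U /= -> Uy; apply=> //; rewrite gt_eqF.
move=> isr; have : ~~ (t i < 0) by rewrite -tneg (negPf isr) andbF.
by rewrite -leNgt => ti; rewrite gt_eqF // ltr_wpDr // mulr_ge0 // ltW.
Qed.

Lemma T_lin_gt0 y i : y \in rts -> i \in T -> 0 < 1 + t i * y.
Proof.
by move=> /rts_pos[y0 _] /T_tpos ti; rewrite addr_gt0 // mulr_gt0.
Qed.

Section Field.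
Variables (F : fieldType) (phi : {rmorphism R -> F}).

Lemma sol_edge y sg i : y \in rts -> phi (sol y sg 0 i) ^+ edge T i = 1 + phi (t i * y).
Proof.
move=> yr; rewrite -rmorphXn -(rmorph1 phi) -rmorphD mxE /edge; congr (phi _).
case: ifP => // iT.
rewrite exprMn -exprM mulnC exprM sqrrN !expr1n mul1r.
by rewrite sqr_sqrtr // ltW ?T_lin_gt0.
Qed.

Lemma wmonE (z : 'rV[F]_n) (y : F) :
  (forall i, z 0 i ^+ edge T i = 1 + phi (t i) * y) ->
  wmon T cexp z = \prod_(i < n) (1 + phi (t i) * y) ^ cexp i.
Proof.
by move=> h; apply: eq_bigr => i _; rewrite -exprz_exp -exprnP h.
Qed.

Lemma sol_neq0 y sg i : y \in rts -> sol y sg 0 i != 0.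
Proof.
move=> yr; rewrite mxE; case: ifP => [iT|_]; last exact: rts_lin_neq0.
by rewrite mulf_neq0 ?signr_eq0 // gt_eqF // sqrtr_gt0 T_lin_gt0.
Qed.

Lemma root_sides (y : F) :
  root (map_poly phi ((sides s t (s + r)).1 - (sides s t (s + r)).2)) y =
  (y \in map phi rts).
Proof.
rewrite rtsE map_polyZ /= rootZ ?fmorph_eq0 //.
rewrite rmorph_prod /= (eq_bigr (fun z => 'X - (phi z)%:P)); last first.
  by move=> z _; rewrite rmorphB /= map_polyX map_polyC.
by rewrite -(big_map phi xpredT (fun z => 'X - z%:P)) root_prod_XsubC.
Qed.

Lemma wmon_sol y sg : y \in rts -> wmon T cexp (map_mx phi (sol y sg)) = phi y.
Proof.
move=> yr; rewrite (@wmonE _ (phi y)); last first.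
  by move=> i; rewrite mxE sol_edge // rmorphM.
apply/esym/eqP; rewrite -sides_eqE //; last first.
  move=> i _; rewrite -rmorphM -(rmorph1 phi) -rmorphD fmorph_eq0.
  exact: rts_lin_neq0.
- by rewrite fmorph_eq0 gt_eqF //; case: (rts_pos yr).
- by rewrite root_sides map_f.
Qed.

(** One list of real points describes the solutions over every extension [F]. For a solution [z],
    the monomial value [w] is a root of [D - U], hence in [rts], and each coordinate in [T] is one
    of two opposite real square roots. *)
Lemma solutionsP (z : 'rV[F]_n) :
  ((forall i, z 0 i != 0) /\
   (forall i, z 0 i ^+ edge T i = 1 + phi (t i) * wmon T cexp z)) <->
  z \in [seq map_mx phi (sol y sg) | y <- rts, sg <- enum (powerset T)].
Proof.
split=> [[z0 zE]|/allpairsP[[y sg] /= [yr _ ->]]]; last first.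
  split=> i; first by rewrite mxE fmorph_eq0 sol_neq0.
  by rewrite wmon_sol // mxE sol_edge // rmorphM.
set w := wmon T cexp z in zE *.
have w0 : w != 0 by apply/prodf_neq0 => i _; apply: expfz_neq0.
(* These terms are powers of the nonzero coordinates of [z]. *)
have lin0 i (isr : (i < s + r)%N) : 1 + phi (t i) * w != 0.
  have iN : (i < n)%N by apply: leq_trans isr srn.
  by rewrite (_ : t i = t (Ordinal iN)) // -zE expf_neq0.
have /mapP[y yr wE] : w \in map phi rts.
  by rewrite -root_sides (@sides_eqE _ _ _ _ _ n) // -(wmonE zE) eqxx.
pose q i := phi (Num.sqrt (1 + t i * y)).
apply/allpairsP; exists (y, [set i in T | z 0 i != q i]); split=> //=.
  by rewrite mem_enum powersetE; apply/subsetP => i; rewrite inE => /andP[].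
apply/rowP => i; rewrite !mxE inE; have := zE i; rewrite wE -rmorphM /edge.
case: ifP => iT; last by rewrite expr1 rmorphD rmorph1.
rewrite /= -(rmorph1 phi) -rmorphD -[X in phi X]sqr_sqrtr ?ltW ?T_lin_gt0 //.
rewrite [phi (_ ^+ 2)]rmorphXn -/(q i) => /eqP; rewrite eqf_sqr.
case: (eqVneq (z 0 i) (q i)) => [->|_ /= /eqP ->]; rewrite iT /=.
  by rewrite expr0 mul1r.
by rewrite expr1 mulN1r rmorphN.
Qed.

(** The root is recovered as the value of the monomial, the signs from the coordinates in [T]. *)
Lemma solutions_uniq : uniq rts ->
  uniq [seq map_mx phi (sol y sg) | y <- rts, sg <- enum (powerset T)].
Proof.
move=> urts; apply: allpairs_uniq => //; first exact: enum_uniq.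
move=> [y1 g1] [y2 g2] /allpairsP[[x1 h1] /= [x1r h1T [-> ->]]].
move=> /allpairsP[[x2 h2] /= [x2r h2T [-> ->]]] E.
have xE : x1 = x2.
  by apply: (fmorph_inj phi); rewrite -(wmon_sol h1 x1r) -(wmon_sol h2 x2r) E.
rewrite -xE in E *; congr (_, _); apply/setP => i.
move: h1T h2T; rewrite !mem_enum !powersetE => /subsetP h1T /subsetP h2T.
have [iT|iT] := boolP (i \in T); last first.
  by rewrite (contraNF (h1T i) iT) (contraNF (h2T i) iT).
have := congr1 (fun u : 'rV_n => u 0 i) E.
have sq0 : Num.sqrt (1 + t i * x1) != 0 by rewrite gt_eqF // sqrtr_gt0 T_lin_gt0.
by rewrite !mxE iT => /(fmorph_inj phi) /(mulIf sq0) /signr_inj.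
Qed.

Lemma size_solutions :
  size [seq map_mx phi (sol y sg) | y <- rts, sg <- enum (powerset T)]
  = (size rts * 2 ^ #|T|)%N.
Proof. by rewrite size_allpairs -cardE card_powerset. Qed.
End Field.
End Solutions.

(** * Counting lattice points *)

Section Counting.
Local Open Scope nat_scope.

Section Compositions.
Variable d : nat.
Implicit Types (k S : nat) (mu : {ffun 'I_d.+1 -> nat}).

Lemma compositions k : exists L : seq {ffun 'I_d.+1 -> nat},
  [/\ uniq L, size L = 'C(d + k, d) & forall mu, (mu \in L) = (\sum_i mu i == k)].
Proof.
pose g (t : (d.+1).-tuple 'I_k.+1) := [ffun i => tnth t i : nat].
pose A := [set t : (d.+1).-tuple 'I_k.+1 | \sum_(i <- t) i == k].
have sumE (t : (d.+1).-tuple 'I_k.+1) : \sum_(i <- t) (i : nat) = \sum_i g t i.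
  by rewrite big_tuple; apply: eq_bigr => i _; rewrite ffunE.
exists [seq g t | t <- enum A]; split.
- rewrite map_inj_uniq ?enum_uniq // => t u /ffunP E; apply: eq_from_tnth => i.
  by apply: val_inj; have := E i; rewrite !ffunE.
- by rewrite size_map -cardE card_ord_partitions.
move=> mu; apply/mapP/eqP => [[t]|muk].
  by rewrite mem_enum inE sumE => /eqP <- ->.
have mule i : mu i < k.+1 by rewrite ltnS -muk (bigD1 i) //= leq_addr.
have E : mu = g [tuple Ordinal (mule i) | i < d.+1].
  by apply/ffunP => i; rewrite ffunE tnth_mktuple.
by exists [tuple Ordinal (mule i) | i < d.+1]; rewrite // mem_enum inE sumE -E muk.
Qed.

(* The compositions from which the positive part of the relation cannot be
   subtracted: one representative per class. *)
Definition reduced (lp : 'I_d.+1 -> nat) k mu :=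
  (\sum_i mu i == k) && [exists i, mu i < lp i].

(** Subtracting [lp] maps the compositions that are not reduced bijectively to those of
    [k - \sum_i lp i]. *)
Lemma reduced_compositions (lp : 'I_d.+1 -> nat) k : \sum_i lp i <= k ->
  exists L : seq {ffun 'I_d.+1 -> nat},
  [/\ uniq L, size L + 'C(d + (k - \sum_i lp i), d) = 'C(d + k, d) &
      forall mu, (mu \in L) = reduced lp k mu].
Proof.
move=> Sk; have [L [uL sL LP]] := compositions k.
have [L' [uL' sL' LP']] := compositions (k - \sum_i lp i).
pose P mu := [exists i, mu i < lp i].
exists [seq mu <- L | P mu]; split.
- exact: filter_uniq.
- rewrite -sL -sL' size_filter -(count_predC P L) -[count (predC P) _]size_filter.
  congr (_ + _).
  pose sh mu : {ffun 'I_d.+1 -> nat} := [ffun i => mu i + lp i].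
  have sh_inj : injective sh.
    move=> u v /ffunP E; apply/ffunP => i.
    by have := E i; rewrite !ffunE => /addIn.
  rewrite -(size_map sh); apply/perm_size/uniq_perm.
  + by rewrite map_inj_uniq.
  + exact: filter_uniq.
  move=> mu; rewrite mem_filter LP /= negb_exists; apply/mapP/andP.
    move=> [v]; rewrite LP' => /eqP vE ->; split.
      by apply/forallP => i; rewrite ffunE -leqNgt leq_addl.
    under eq_bigr => i _ do rewrite ffunE.
    by rewrite big_split /= vE subnK.
  move=> [/forallP lpmu /eqP muk]; exists [ffun i => mu i - lp i].
    rewrite LP' -muk -sumnB; last by move=> i _; rewrite leqNgt.
    by apply/eqP; apply: eq_bigr => i _; rewrite ffunE.
  by apply/ffunP => i; rewrite !ffunE subnK // leqNgt.
- by move=> mu; rewrite mem_filter LP andbC.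
Qed.
End Compositions.

Lemma leq_expn2r m n e : m <= n -> m ^ e <= n ^ e.
Proof. by case: e => // e mn; rewrite leq_exp2r. Qed.

Lemma ffact_bounds n j : j ^ n <= (n + j) ^_ n <= (n + j) ^ n.
Proof.
elim: n => [|n /andP[lo hi]]; first by rewrite ffactn0.
rewrite addSn ffactSS !expnS; apply/andP; split; apply: leq_mul => //.
  by rewrite leqW // leq_addl.
by apply: leq_trans hi _; apply: leq_expn2r.
Qed.

(** By Pascal's rule [X] is a sum of [S] binomials ['C(n + (k - i), n)], [i < S]; [ffact_bounds]
    estimates [n!] times each. *)
Lemma bin_diff_bounds n k S X : S <= k ->
  X + 'C(n.+1 + (k - S), n.+1) = 'C(n.+1 + k, n.+1) ->
  S * (k - S) ^ n <= n`! * X <= S * (k + n) ^ n.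
Proof.
elim: S X => [|S IH] X Sk.
  by rewrite subn0 -[RHS]add0n => /addIn ->; rewrite muln0.
have kE : k - S = (k - S.+1).+1 by lia.
have le : 'C(n.+1 + (k - S), n.+1) <= 'C(n.+1 + k, n.+1).
  by apply: leq_bin2l; rewrite leq_add2l leq_subr.
have /andP[lo hi] := IH _ (ltnW Sk) (subnK le).
move=> XE; have -> : X = 'C(n.+1 + k, n.+1) - 'C(n.+1 + (k - S), n.+1)
    + 'C(n + (k - S), n).
  apply: (@addIn 'C(n.+1 + (k - S.+1), n.+1)); rewrite XE -[LHS](subnK le).
  by rewrite kE !addnS addSn binS addnA addnAC addSn.
have /andP[lo' hi'] := ffact_bounds n (k - S).
rewrite mulnDr [n`! * 'C(n + _, n)]mulnC bin_ffact !mulSn !(addnC _ (S * _)).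
apply/andP; split; apply: leq_add.
- by apply: leq_trans lo; rewrite leq_mul2l leq_expn2r ?orbT // leq_sub2l.
- by apply: leq_trans lo'; apply: leq_expn2r; apply: leq_sub2l.
- exact: hi.
- by apply: leq_trans hi' _; apply: leq_expn2r; rewrite addnC leq_add2r leq_subr.
Qed.

End Counting.

(** * Lattice points of the dilates modulo the affine relation *)

Section LatticePoints.
Variables (n : nat) (T : {set 'I_n}) (b : 'I_n -> int).
Notation p_ := (cpts T b).

(* Normalized to [-1] at [w]; the sum has a single term. *)
Definition relc (k : 'I_n.+2) : int :=
  if k == ord0 then 1 - \sum_i b i
  else if k == ord_max then -1 else \sum_(i | axis i == k) b i.

Lemma relc0 : relc ord0 = 1 - \sum_i b i.
Proof. by rewrite /relc eqxx. Qed.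

Lemma relc_max : relc ord_max = -1.
Proof. by rewrite /relc max_neq0 eqxx. Qed.

Lemma relc_axis i : relc (axis i) = b i.
Proof.
rewrite /relc axis_neq0 axis_neqmax (bigD1 i) //= big1 ?addr0 //.
by move=> j /andP[/eqP/axis_inj ->]; rewrite eqxx.
Qed.

Lemma sum_relc : \sum_k relc k = 0.
Proof.
rewrite big_axis /= relc0 relc_max; under eq_bigr => i _ do rewrite relc_axis.
ring.
Qed.

Definition posrel k : nat := if 0 <= relc k then `|relc k|%N else 0%N.
(** The volume of the convex hull in units of the simplex with vertices 0 and [a_i e_i], as
    [volume_limit] shows. *)
Definition vol : nat := (\sum_k posrel k)%N.

(* [sg] records the coset modulo the lattice spanned by the [a_i e_i]. *)
Definition lat (sg : {set 'I_n}) (mu : {ffun 'I_n.+2 -> nat}) : 'rV[int]_n :=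
  \row_i ((i \in sg)%:R + (edge T i)%:Z * ((mu (axis i))%:Z + b i * (mu ord_max)%:Z)).

(** Adding a positive multiple of the relation to [v] would make [u] at least [posrel]
    everywhere. *)
Lemma reduced_no_shift (u v : {ffun 'I_n.+2 -> nat}) (e : int) k :
  reduced posrel k u -> (forall i, (u i)%:Z = (v i)%:Z + e * relc i) -> e <= 0.
Proof.
rewrite /reduced => /andP[_ /existsP[i ui]] E; rewrite leNgt; apply/negP => e0.
move: ui (E i); rewrite /posrel; case: ifP => // r0 ui ei.
have : (u i)%:Z < relc i by move: ui; lia.
have : relc i <= e * relc i by rewrite ler_peMl //; lia.
lia.
Qed.

(** Parity in the coordinates of [T] determines the coset. Then [u - v] is a multiple of the
    relation, and [reduced_no_shift], applied both ways, makes it zero. *)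
Lemma lat_inj k (sg sg' : {set 'I_n}) (u v : {ffun 'I_n.+2 -> nat}) :
  sg \subset T -> sg' \subset T -> reduced posrel k u -> reduced posrel k v ->
  lat sg u = lat sg' v -> sg = sg' /\ u = v.
Proof.
move=> /subsetP sT /subsetP sT' ru rv /rowP E.
have sE i : (i \in sg) = (i \in sg').
  have [iT|iT] := boolP (i \in T); last first.
    by rewrite (contraNF (sT i) iT) (contraNF (sT' i) iT).
  have := E i; rewrite !mxE /edge iT /=; case: (i \in sg); case: (i \in sg') => //=; lia.
split; first exact/setP.
(* The multiple is read off at [w], where the relation has coefficient -1. *)
pose e : int := (v ord_max)%:Z - (u ord_max)%:Z.
have Ea i : (u (axis i))%:Z = (v (axis i))%:Z + e * b i.
  have := E i; rewrite !mxE sE => /addrI /mulfI -/(_ isT) h.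
  by rewrite /e; move: h; set x := b i; set y := u _; set z := v _; lia.
have Euv i : (u i)%:Z = (v i)%:Z + e * relc i.
  elim/ord_axisP: i => [|i|]; last by rewrite relc_max /e; lia.
    have [/eqP uk _] := andP ru; have [/eqP vk _] := andP rv.
    have : (\sum_i u i)%:Z = (\sum_i v i)%:Z by rewrite uk vk.
    rewrite relc0 !big_axis /= !PoszD !(big_morph Posz PoszD (erefl _)).
    rewrite (eq_bigr _ (fun i _ => Ea i)) big_split /= -mulr_sumr -/e mulrBr mulr1.
    move: (e * _) (\sum_(i < n) _) => X Y; rewrite /e. lia.
  by rewrite relc_axis Ea.
have e1 := reduced_no_shift ru Euv.
have e2 : - e <= 0.
  by apply: (reduced_no_shift (v := u) rv) => i; rewrite Euv mulNr addrK.
have e0 : e = 0 by lia.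
by apply/ffunP => i; have := Euv i; rewrite e0 mul0r addr0 => -[].
Qed.

(** The relation is subtracted as long as possible; a coordinate [k0] with positive coefficient
    decreases each time. *)
Lemma lat_reduce k sg (u : {ffun 'I_n.+2 -> nat}) : (0 < vol)%N ->
  (\sum_i u i = k)%N -> exists2 v, reduced posrel k v & lat sg v = lat sg u.
Proof.
move=> v0.
have [k0 k0P] : exists k0, (0 < posrel k0)%N.
  apply/existsP; apply: contraTT v0; rewrite negb_exists => /forallP h.
  by rewrite -leqNgt /vol big1 // => i _; apply/eqP; rewrite -leqn0 leqNgt.
have [N] := ubnP (u k0); elim: N u => // N IH u uN uk.
have [ru|] := boolP (reduced posrel k u); first by exists u.
rewrite /reduced uk eqxx /= negb_exists => /forallP h.
pose u' : {ffun 'I_n.+2 -> nat} := [ffun i => `|(u i)%:Z - relc i|%N].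
have u'E i : (u' i)%:Z = (u i)%:Z - relc i.
  rewrite ffunE gez0_abs //; have := h i; rewrite -leqNgt /posrel; case: ifP; lia.
have [||v rv vE] := IH u'.
- have := u'E k0; move: k0P; rewrite /posrel; case: ifP => //; lia.
- apply/eqP; rewrite -eqz_nat -uk !(big_morph Posz PoszD (erefl _)).
  by rewrite (eq_bigr _ (fun i _ => u'E i)) sumrB sum_relc subr0.
exists v => //; rewrite vE; apply/rowP => i; rewrite !mxE; congr (_ + _ * _).
by rewrite !u'E relc_axis relc_max; ring.
Qed.

Lemma comb_ptR (lam : 'I_n.+2 -> R) i :
  (\sum_k lam k *: ptR p_ k) 0 i =
  (edge T i)%:R * (lam (axis i) + (b i)%:~R * lam ord_max).
Proof.
rewrite summxE; have E k : (lam k *: ptR p_ k) 0 i = lam k * (p_ k 0 i)%:~R.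
  by rewrite !mxE.
rewrite (eq_bigr _ (fun k _ => E k)) big_axis /= cpts0 mxE mulr0 add0r.
rewrite (bigD1 i) //= big1 ?addr0; last first.
  by move=> j /negPf ji; rewrite cpts_axis ji mulr0.
rewrite cpts_axis eqxx cpts_max rmorphM /= -!pmulrn; ring.
Qed.

(* Dilation by [K.+1], to match the index shift in [normalized_volume_is]. *)
Definition dilate K (p : 'rV[int]_n) : Prop :=
  in_conv p_ ((K.+1%:R)^-1 *: map_mx (fun z : int => z%:~R) p).

(** The coset offset in coordinate [i] is half of [a_i e_i]. The slack [n], placed at the origin,
    pays for these halves. *)
Lemma lat_dilate K (sg : {set 'I_n}) (u : {ffun 'I_n.+2 -> nat}) :
  sg \subset T -> (\sum_i u i + n = K.+1)%N -> dilate K (lat sg u).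
Proof.
move=> /subsetP sT uK.
pose h i : R := (i \in sg)%:R / 2.
pose f k : R := if k == ord0 then (u k)%:R + n%:R - \sum_i h i
  else (u k)%:R + \sum_(i | axis i == k) h i.
have h01 i : 0 <= h i <= 1 by rewrite /h; case: (i \in sg) => /=; lra.
have f0 : f ord0 = (u ord0)%:R + n%:R - \sum_i h i by rewrite /f eqxx.
have fa i : f (axis i) = (u (axis i))%:R + h i.
  rewrite /f axis_neq0 (bigD1 i) //= big1 ?addr0 //.
  by move=> j /andP[/eqP/axis_inj ->]; rewrite eqxx.
have fm : f ord_max = (u ord_max)%:R.
  by rewrite /f max_neq0 big1 ?addr0 // => i /eqP/eqP; rewrite axis_neqmax.
have K0 : 0 < K.+1%:R :> R by rewrite ltr0n.
have fpos k : 0 <= f k.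
  elim/ord_axisP: k => [|i|]; rewrite ?f0 ?fa ?fm ?ler0n //.
    rewrite -addrA addr_ge0 // ?ler0n // subr_ge0.
    have -> : n%:R = \sum_(i < n) 1 :> R by rewrite sumr_const card_ord.
    by apply: ler_sum => i _; case/andP: (h01 i).
  by rewrite addr_ge0 ?ler0n //; case/andP: (h01 i).
exists (fun k => f k / K.+1%:R); split.
- by move=> k; rewrite divr_ge0 // ltW.
- rewrite -mulr_suml big_axis /= f0 fm.
  under eq_bigr => i _ do rewrite fa.
  rewrite big_split /= -[RHS](divff (lt0r_neq0 K0)) -uK big_axis /=.
  by rewrite !natrD natr_sum; congr (_ / _); ring.
apply/rowP => i; rewrite comb_ptR fa fm !mxE.
rewrite !rmorphD rmorphM rmorphD rmorphM /= -!pmulrn.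
rewrite rmorph_nat; have -> : (i \in sg)%:R = (edge T i)%:R * h i.
  rewrite /h /edge; have [/sT ->|_] := boolP (i \in sg); rewrite ?mul0r ?mulr0 //=.
  by field.
by have := lt0r_neq0 K0; move: (K.+1%:R) => k k0; field.
Qed.

Hypothesis b_le2 : forall i, `|b i| <= 2.

(* Replace the coefficient of [w] by its integer part and the other ones by the
   integers this forces: each moves by a bounded amount, which the shift by
   [3 a_i e_i] makes up for. *)
Lemma dilate_lat K p : dilate K p -> exists (sg : {set 'I_n}) (u : {ffun 'I_n.+2 -> nat}),
  [/\ sg \subset T, (\sum_i u i = K.+1 + 6 * n)%N &
      p + \row_i (3 * (edge T i)%:Z) = lat sg u].
Proof.
case=> lam [lam0 lam1 /rowP pE].
have K0 : 0 < K.+1%:R :> R by rewrite ltr0n.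
pose M k : R := K.+1%:R * lam k.
have M0 k : 0 <= M k by rewrite mulr_ge0 // ltW.
have ME : \sum_k M k = K.+1%:R by rewrite -mulr_sumr lam1 mulr1.
have {}pE i : (p 0 i)%:~R = (edge T i)%:R * (M (axis i) + (b i)%:~R * M ord_max).
  have := pE i; rewrite comb_ptR !mxE /M => /(congr1 ( *%R K.+1%:R)).
  by rewrite mulVKf ?lt0r_neq0 // => ->; ring.
pose u := Num.truncn (M ord_max).
have /andP[u1 u2] := truncn_itv (M0 ord_max).
pose th : R := M ord_max - u%:R.
have th01 : 0 <= th < 1 by rewrite /th -/u; move: u1 u2; rewrite -/u -natr1; lra.
pose pc i := p 0 i.
pose sg := [set i in T | (pc i %% 2)%Z != 0].
pose q i : int := (pc i %/ (edge T i)%:Z)%Z.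
have pq i : p 0 i = (i \in sg)%:R + (edge T i)%:Z * q i.
  rewrite -/(pc i) /q /edge inE; case: (i \in T) => /=; last by rewrite divz1; lia.
  have := divz_eq (pc i) 2; have := modz_ge0 (pc i) (isT : 2 != 0 :> int).
  have := ltz_mod (pc i) (isT : 2 != 0 :> int).
  by set x := (_ %% _)%Z; set y := (_ %/ _)%Z; case: eqP => /=; lia.
pose rho i : R := (i \in sg)%:R / (edge T i)%:R.
have e0 i : (edge T i)%:R != 0 :> R by rewrite pnatr_eq0.
have rho01 i : 0 <= rho i <= 1.
  by rewrite /rho /edge inE; case: (i \in T); case: (_ != _) => /=; lra.
pose nu i : int := q i - b i * u%:Z.
have nuE i : (nu i)%:~R = M (axis i) + (b i)%:~R * th - rho i.
  have /(congr1 (fun z : int => z%:~R : R)) := pq i.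
  rewrite pE rmorphD rmorphM /= rmorph_nat -!pmulrn => h.
  have {h} -> : M (axis i) = (q i)%:~R + rho i - (b i)%:~R * M ord_max.
    have er : (edge T i)%:R * rho i = (i \in sg)%:R by rewrite mulrC divfK.
    apply: (mulfI (e0 i)); move: h; rewrite -er; lra.
  by rewrite /nu /th rmorphB rmorphM /= -!pmulrn; ring.
have bth i : `|(b i)%:~R * th| <= 2.
  have h1 : `|(b i)%:~R| <= 2 :> R by rewrite -intr_norm (ler_int _ _ 2).
  have h2 : `|th| <= 1 by rewrite ger0_norm; lra.
  by rewrite normrM -[2]mulr1; apply: ler_pM.
(* The constant 3 comes from [|b i * th| <= 2] and [rho i <= 1]. *)
have nu_ge i : 0 <= nu i + 3.
  rewrite -(ler_int R) rmorphD /= nuE.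
  have := bth i; rewrite ler_norml => /andP[+ _].
  by have := M0 (axis i); have := rho01 i; lra.
(* The origin takes the rest of the total [K + 1]. Adding 3 to each axis weight and [3 n] at the
   origin makes all weights nonnegative, hence [6 n]. *)
pose nu0 : int := K.+1%:Z - u%:Z - \sum_i nu i.
have nu0_ge : 0 <= nu0 + 3 * n%:Z.
  rewrite -(ler_int R) rmorphD !rmorphB rmorph_sum rmorphM /= -!pmulrn -ME.
  rewrite (eq_bigr _ (fun i _ => nuE i)) big_axis /= sumrB big_split /=.
  suff : - (3 * n%:R) <= \sum_i rho i - \sum_i (b i)%:~R * th.
    by have := M0 ord0; move: th01; rewrite /th; lra.
  rewrite -sumrB; have -> : - (3 * n%:R) = \sum_(i < n) - 3 :> R.
    by rewrite sumr_const card_ord -[RHS]mulr_natr mulNr.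
  apply: ler_sum => i _; have := bth i; rewrite ler_norml => /andP[_ +].
  by have := rho01 i; lra.
pose v : {ffun 'I_n.+2 -> nat} := [ffun k : 'I_n.+2 => if k == ord0 then absz (nu0 + 3 * n%:Z)
  else if k == ord_max then u else absz (\sum_(i | axis i == k) (nu i + 3))].
have v0 : (v ord0)%:Z = nu0 + 3 * n%:Z by rewrite ffunE eqxx gez0_abs.
have vm : v ord_max = u by rewrite ffunE max_neq0 eqxx.
have va i : (v (axis i))%:Z = nu i + 3.
  rewrite ffunE axis_neq0 axis_neqmax (bigD1 i) //= big1 ?addr0 ?gez0_abs //.
  by move=> j /andP[/eqP/axis_inj ->]; rewrite eqxx.
exists sg, v; split.
- by apply/subsetP => i; rewrite inE => /andP[].
- apply/eqP; rewrite -eqz_nat (big_morph Posz PoszD (erefl _)) big_axis /=.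
  rewrite v0 vm (eq_bigr _ (fun i _ => va i)) big_split /= sumr_const card_ord.
  rewrite /nu0 -[3 *+ n]mulr_natr [n%:R]natz.
  by move: (\sum_(i < n) nu i) => X; lia.
apply/rowP => i; rewrite !mxE va vm pq /nu; ring.
Qed.
End LatticePoints.

(** [P] is turned into a boolean filter classically. *)
Lemma has_card_sub (X : eqType) (P : X -> Prop) (L : seq X) :
  (forall x, P x -> x \in L) ->
  exists2 s : seq X, uniq s & forall x, P x <-> x \in s.
Proof.
move=> PL; exists [seq x <- undup L | boolp.asbool (P x)].
  by rewrite filter_uniq ?undup_uniq.
move=> x; rewrite mem_filter mem_undup; split=> [Px|/andP[/boolp.asboolP //]].
by rewrite PL // andbT; apply/boolp.asboolP.
Qed.

(** * The volume as a limit of lattice point counts *)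

Section Count.
Variables (n : nat) (T : {set 'I_n}) (b : 'I_n -> int).
Hypothesis b_le2 : forall i, `|b i| <= 2.
Hypothesis vol_gt0 : (0 < vol b)%N.
Hypothesis vol_le : (vol b <= 6 * n)%N.

Lemma lat_seq k : (vol b <= k)%N -> exists L : seq 'rV[int]_n,
  [/\ uniq L,
      (2 ^ #|T| * vol b * (k - vol b) ^ n <= n`! * size L)%N,
      (n`! * size L <= 2 ^ #|T| * vol b * (k + n) ^ n)%N &
      forall p, p \in L <->
        exists (sg : {set 'I_n}) u,
          [/\ sg \subset T, reduced (posrel b) k u & p = lat T b sg u]].
Proof.
move=> vk; have [U [uU sU UP]] := reduced_compositions vk.
have /andP[lo hi] := bin_diff_bounds vk sU.
exists [seq lat T b sg u | sg <- enum (powerset T), u <- U]; split.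
- apply: allpairs_uniq => //; first exact: enum_uniq.
  move=> [s1 u1] [s2 u2] /allpairsP[[x1 y1] /= [x1T y1U [-> ->]]].
  move=> /allpairsP[[x2 y2] /= [x2T y2U [-> ->]]].
  move: x1T x2T; rewrite !mem_enum !powersetE => x1T x2T.
  by move/lat_inj => /(_ k x1T x2T) []; rewrite -?UP // => -> ->.
- by rewrite size_allpairs -cardE card_powerset mulnCA -mulnA leq_mul2l lo orbT.
- by rewrite size_allpairs -cardE card_powerset mulnCA -mulnA leq_mul2l hi orbT.
move=> p; split=> [/allpairsP[[sg u] /= [sT uU' ->]]|[sg [u [sT ru ->]]]].
  by exists sg, u; split=> //; rewrite -?UP //; rewrite mem_enum powersetE in sT.
by apply/allpairsP; exists (sg, u); split=> //=; rewrite ?UP // mem_enum powersetE.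
Qed.

(** The count lies between those of [lat_seq] for [K + 1 - n] and, after translation, [K + 1 + 6 n];
    with [vol b <= 6 n], both errors fit into [7 n]. *)
Lemma dilate_count K : exists N : nat,
  [/\ has_card (dilate T b K) N,
      (2 ^ #|T| * vol b * (K.+1 - 7 * n) ^ n <= n`! * N)%N &
      (n`! * N <= 2 ^ #|T| * vol b * (K.+1 + 7 * n) ^ n)%N].
Proof.
have [|L [uL _ szL LP]] := @lat_seq (K.+1 + 6 * n).
  by rewrite (leq_trans vol_le) // leq_addl.
pose h : 'rV[int]_n := \row_i (3 * (edge T i)%:Z).
have AL p : dilate T b K p -> p \in [seq x - h | x <- L].
  move=> /(dilate_lat b_le2)[sg [u [sT uK ph]]]; apply/mapP; exists (p + h).
    apply/LP; have [v rv vE] := lat_reduce T sg vol_gt0 uK.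
    by exists sg, v; split=> //; rewrite vE.
  by rewrite addrK.
have [S uS SP] := has_card_sub AL; exists (size S); split.
- by exists S.
(* For small [K] the truncated difference is 0 and the lower bound trivial, as [n > 0]. *)
- have [Kn|Kn] := leqP (7 * n) K.+1; last first.
    rewrite (_ : (_ - _ = 0)%N); last by apply/eqP; rewrite subn_eq0 ltnW.
    by rewrite exp0n ?muln0 //; move: vol_le vol_gt0; lia.
  have [|L' [uL' szL' _ LP']] := @lat_seq (K.+1 - n); first by lia.
  have sub : {subset L' <= S}.
    move=> p /LP'[sg [u [sT /andP[/eqP uK _] ->]]]; apply/SP/lat_dilate => //.
    by rewrite uK; lia.
  apply: leq_trans (_ : n`! * size L' <= _)%N; last first.
    by rewrite leq_mul2l uniq_leq_size ?orbT.
  apply: leq_trans szL'; rewrite leq_mul2l; apply/orP; right.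
  by apply: leq_expn2r; lia.
- apply: leq_trans (_ : n`! * size L <= _)%N; first rewrite leq_mul2l.
    rewrite -(size_map (fun x => x - h) L) uniq_leq_size ?orbT //.
    by move=> p /SP/AL.
  apply: leq_trans szL _; rewrite leq_mul2l; apply/orP; right.
  by apply: leq_expn2r; lia.
Qed.

Lemma expr_sub1_le (x : R) k : 0 <= x <= 2 ->
  `|x ^+ k - 1| <= (k * 2 ^ k)%:R * `|x - 1|.
Proof.
move=> /andP[x0 x2]; elim: k => [|k IH]; first by rewrite expr0 subrr normr0 mul0r.
have -> : x ^+ k.+1 - 1 = x ^+ k * (x - 1) + (x ^+ k - 1) by rewrite exprSr; ring.
apply: (le_trans (ler_normD _ _)); rewrite normrM.
have h1 : `|x ^+ k| <= (2 ^ k)%:R.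
  by rewrite normrX ger0_norm // natrX lerXn2r // nnegrE.
have h2 : (2 ^ k)%:R + (k * 2 ^ k)%:R <= (k.+1 * 2 ^ k.+1)%:R :> R.
  by rewrite -natrD ler_nat -mulSn leq_mul2l leq_pexp2l ?orbT.
apply: le_trans (ler_wpM2r (normr_ge0 _) h2).
by rewrite mulrDl; apply: lerD IH; apply: ler_wpM2r.
Qed.

Lemma volume_limit : normalized_volume_is (cpts T b) (2 ^ #|T| * vol b)%:R.
Proof.
have [cnt cntP] := boolp.choice dilate_count.
exists cnt; split=> [k|]; first by have [] := cntP k.
move=> eps /RltP eps0.
pose D : R := (2 ^ #|T| * vol b)%:R; pose f : R := (n`!)%:R.
have f0 : 0 < f by rewrite ltr0n fact_gt0.
have D0 : 0 <= D by rewrite ler0n.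
pose B : R := D / f * (n * 2 ^ n)%:R * (7 * n)%:R.
have B0 : 0 <= B by rewrite /B !mulr_ge0 ?ler0n // invr_ge0 ltW.
(* The first summand ensures [c <= K], so that [xl] is nonnegative; the second ensures
   [B / K < eps]. *)
exists (7 * n + Num.truncn (B / eps))%N => k /ssrnat.leP kN; apply/RltP.
rewrite RdistE.
have [_] := cntP k; set N := cnt k; set c := (7 * n)%N => lo hi.
set K : R := k.+1%:R; have K0 : 0 < K by rewrite ltr0n.
have cK : (c <= k.+1)%N by rewrite (leq_trans _ (leqW kN)) // leq_addr.
have Kn0 : 0 < K ^+ n by rewrite exprn_gt0.
have BK : B / K < eps.
  rewrite ltr_pdivrMr // mulrC -ltr_pdivrMr //.
  apply: lt_le_trans (truncnS_gt _) _; rewrite ler_nat ltnS.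
  by rewrite (leq_trans _ kN) // leq_addl.
have dev (x : R) : 0 <= x <= 2 -> `|x - 1| = c%:R / K ->
    `|D / f * x ^+ n - D / f| <= B / K.
  move=> x02 xE; rewrite -[X in _ - X]mulr1 -mulrBr normrM.
  rewrite ger0_norm ?divr_ge0 ?(ltW f0) //.
  apply: le_trans (ler_wpM2l _ (expr_sub1_le n x02)) _; first by rewrite divr_ge0 // ltW.
  by rewrite xE /B !mulrA.
pose xl := (K - c%:R) / K; pose xu := (K + c%:R) / K.
have cKR : c%:R <= K by rewrite ler_nat.
have xlE : xl = 1 - c%:R / K by rewrite /xl mulrBl divff ?gt_eqF.
have xuE : xu = 1 + c%:R / K by rewrite /xu mulrDl divff ?gt_eqF.
have cK1 : 0 <= c%:R / K <= 1 by apply/andP; split;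
  [rewrite divr_ge0 // ltW | rewrite ler_pdivrMr // mul1r].
have hl : `|D / f * xl ^+ n - D / f| <= B / K.
  apply: dev; rewrite xlE; first by move: cK1; move: (c%:R / K) => z; lra.
  by rewrite addrC addKr normrN ger0_norm //; case/andP: cK1.
have hu : `|D / f * xu ^+ n - D / f| <= B / K.
  apply: dev; rewrite xuE; first by move: cK1; move: (c%:R / K) => z; lra.
  by rewrite addrC addKr ger0_norm //; case/andP: cK1.
have yl : D / f * xl ^+ n <= N%:R / K ^+ n.
  rewrite /xl expr_div_n mulrA ler_pM2r ?invr_gt0 // mulrAC ler_pdivrMr //.
  rewrite -natrB // /D /f -natrX -!natrM ler_nat [(N * _)%N]mulnC; exact: lo.
have yu : N%:R / K ^+ n <= D / f * xu ^+ n.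
  rewrite /xu expr_div_n mulrA ler_pM2r ?invr_gt0 // mulrAC ler_pdivlMr //.
  rewrite -natrD /D /f -natrX -!natrM ler_nat [(N * _)%N]mulnC; exact: hi.
apply: le_lt_trans BK; move: hl hu yl yu; rewrite !ler_norml.
move: (D / f * xl ^+ n) (D / f * xu ^+ n) (N%:R / _) (D / f) (B / K).
by move=> el eu y d e; lra.
Qed.
End Count.

(** * Rank and affine dependencies *)

Section CoordinateSpan.
Variables (K : fieldType) (n : nat).

Definition coordmx (J : {set 'I_n}) : 'M[K]_n := \sum_(i in J) delta_mx i i.

Lemma coordmxE J i j : coordmx J i j = ((i == j) && (i \in J))%:R.
Proof.
rewrite /coordmx summxE; have [iJ|iJ] := boolP (i \in J).
  rewrite (bigD1 i) //= big1 ?addr0 ?mxE ?eqxx /= ?andbT; first by rewrite eq_sym.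
  by move=> k /andP[_ /negPf ki]; rewrite mxE eq_sym ki.
rewrite andbF big1 // => k kJ; rewrite mxE; case: eqP => // ik.
by rewrite ik kJ in iJ.
Qed.

(** The upper bound is subadditivity; applied to the complement as well it gives the lower one,
    since the two matrices add up to the identity. *)
Lemma rank_coordmx J : \rank (coordmx J) = #|J|.
Proof.
have le I : (\rank (coordmx I) <= #|I|)%N.
  rewrite -sum1_card; apply: (big_ind2 (fun (A : 'M_n) k => \rank A <= k)%N).
  - by rewrite mxrank0.
  - move=> A a B b hA hB; apply: leq_trans (mxrank_add _ _) _.
    exact: leq_add.
  - by move=> i _; rewrite mxrank_delta.
apply/eqP; rewrite eqn_leq le /= -(leq_add2r #|~: J|) cardsC card_ord.
apply: leq_trans (leq_add (leqnn _) (le (~: J))).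
apply: leq_trans (mxrank_add _ _).
rewrite (_ : _ + _ = 1%:M) ?mxrank1 //; apply/matrixP => i j.
rewrite mxE !coordmxE inE mxE; case: (i == j); case: (i \in J) => //=.
all: by rewrite ?add0r ?addr0.
Qed.

Lemma rank_coordinate_span q (M : 'M[K]_(q, n)) (J : {set 'I_n}) :
  (forall i, i \in J -> ((delta_mx 0 i : 'rV_n) <= M)%MS) ->
  (forall k i, i \notin J -> M k i = 0) -> \rank M = #|J|.
Proof.
move=> sub0 M0; rewrite -rank_coordmx; apply/eqmx_rank/andP; split.
  have -> : M = M *m coordmx J; last exact: submxMl.
  apply/matrixP => k i; rewrite mxE (bigD1 i) //= big1 ?addr0.
    rewrite coordmxE eqxx /=; have [_|iJ] := boolP (i \in J); first by rewrite mulr1.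
    by rewrite M0 // mul0r.
  by move=> j /negPf ji; rewrite coordmxE ji mulr0.
apply/row_subP => i; have [iJ|iJ] := boolP (i \in J).
  suff -> : row i (coordmx J) = delta_mx 0 i by apply: sub0.
  by apply/rowP => j; rewrite !mxE coordmxE iJ andbT eqxx eq_sym.
suff -> : row i (coordmx J) = 0 by apply: sub0mx.
by apply/rowP => j; rewrite !mxE coordmxE (negPf iJ) andbF.
Qed.
End CoordinateSpan.

Section Circuit.
Variables (n : nat) (T : {set 'I_n}) (b : 'I_n -> int).
Hypothesis relc0_neq0 : relc b ord0 != 0.
Notation p_ := (cpts T b).

(** The coordinates determine the axis weights from the weight of [w], and the zero sum determines
    that of the origin: the relations form a line. *)
Lemma dependency (lam : 'I_n.+2 -> R) : \sum_k lam k = 0 ->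
  \sum_k lam k *: ptR p_ k = 0 ->
  forall k, lam k = - lam ord_max * (relc b k)%:~R.
Proof.
move=> l0 /rowP lp.
have la i : lam (axis i) = - lam ord_max * (b i)%:~R.
  have := lp i; rewrite comb_ptR mxE => /eqP.
  rewrite mulf_eq0 pnatr_eq0 /= addr_eq0 => /eqP ->; ring.
elim/ord_axisP => [|i|]; last by rewrite relc_max; ring.
  move: l0; rewrite big_axis /= (eq_bigr _ (fun i _ => la i)) -mulr_sumr.
  rewrite relc0 rmorphB rmorph_sum /= => h; lra.
by rewrite relc_axis la.
Qed.

Lemma relc_dependency :
  \sum_k (relc b k)%:~R = 0 :> R /\ \sum_k (relc b k)%:~R *: ptR p_ k = 0.
Proof.
split; first by rewrite -rmorph_sum sum_relc.
apply/rowP => i; rewrite comb_ptR relc_axis relc_max mxE; ring.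
Qed.

Definition relsupp : {set 'I_n.+2} := [set k | relc b k != 0].

Lemma aff_depP S : aff_dep p_ S <-> relsupp \subset S.
Proof.
split=> [[lam [[i iS li] lS l0 lp]]|/subsetP sS].
  have lE := dependency l0 lp; apply/subsetP => k; rewrite inE => rk.
  apply: contraTT isT => kS; have /eqP := lS k kS.
  rewrite lE mulf_eq0 oppr_eq0 intr_eq0 (negPf rk) orbF => lm.
  by move: li; rewrite lE (eqP lm) oppr0 mul0r eqxx.
have [r0 rp] := relc_dependency; exists (fun k => (relc b k)%:~R); split=> //.
  by exists ord0; rewrite ?intr_eq0 // sS // inE.
by move=> i iS; apply/eqP; rewrite intr_eq0; apply: contraNT iS => ri; rewrite sS ?inE.
Qed.

Lemma minimal_aff_depP S : minimal_aff_dep p_ S <-> S = relsupp.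
Proof.
split=> [[/aff_depP sS min]|->].
  apply/eqP; rewrite eqEsubset sS andbT; apply/negPn/negP => nS.
  by apply: (min relsupp); [rewrite properE sS|apply/aff_depP].
split; first exact/aff_depP.
by move=> S' /properP[_ [k kr kS']] /aff_depP /subsetP /(_ k kr); apply/negP.
Qed.

(** The span is the coordinate subspace of the axes in [S]: even if [w] is in [S], it has nonzero
    coordinates only along these. *)
Lemma aff_dim_cpts (S : {set 'I_n.+2}) : ord0 \in S ->
  (forall i, b i != 0 -> axis i \in S) -> aff_dim p_ S = #|[set i | axis i \in S]|.
Proof.
move=> S0 Sb; rewrite /aff_dim; case: pickP => [i0 i0S|/(_ ord0)]; last by rewrite S0.
set M := \matrix_k _.
have rowM k : k \in S -> (ptR p_ k - ptR p_ i0 <= M)%MS.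
  by move=> kS; rewrite (_ : _ - _ = row k M) ?row_sub // rowK kS.
have pt0 : ptR p_ ord0 = 0 by rewrite /ptR cpts0 map_mx0.
apply: rank_coordinate_span => [i|k i].
  rewrite inE => iS.
  have -> : delta_mx 0 i = ((edge T i)%:R^-1 : R) *: (ptR p_ (axis i)) :> 'rV_n.
    apply/rowP => j; rewrite !mxE eqxx /=.
    have := cpts_axis T b i j; rewrite mxE => ->.
    rewrite eq_sym; case: eqP => _; last by rewrite mulr0.
    by rewrite -pmulrn mulVf // pnatr_eq0.
  (* The base point [i0] is arbitrary; it cancels against the row of the origin. *)
  apply: scalemx_sub; rewrite -[ptR _ _](subrK (ptR p_ i0)).
  rewrite addmx_sub ?rowM // -[ptR p_ i0]opprK eqmx_opp -[- _]add0r -pt0.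
  exact: rowM.
rewrite inE => iS; rewrite mxE; case: ifP => kS; last by rewrite mxE.
have z k' : k' \in S -> ptR p_ k' 0 i = 0.
  move: k'; apply: ord_axisP => [_|j jS|_]; first by rewrite pt0 mxE.
    rewrite mxE cpts_axis; case: eqP => // ji; by rewrite -ji jS in iS.
  rewrite mxE cpts_max; have /eqP-> : b i == 0 by apply: contraNT iS; apply: Sb.
  by rewrite mulr0.
by rewrite mxE [X in _ + X]mxE !z // subr0.
Qed.

(** Modulo 2, coordinates with [a_i = 2] vanish at all points, while the other axis points become
    unit vectors. *)
Lemma rank_mod2_cpts : rank_mod2 p_ = #|~: T|.
Proof.
pose M : 'M['F_2]_(n.+2, n) := \matrix_(k, i) (p_ k 0 i)%:~R.
have -> : rank_mod2 p_ = \rank M.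
  congr (\rank _); apply/matrixP => k i.
  by rewrite [LHS]mxE cpts0 [X in _ - X]mxE subr0 [RHS]mxE.
have two0 : 2%:R = 0 :> 'F_2 by apply/eqP.
apply: rank_coordinate_span => [i|k i]; rewrite inE ?negbK => iT.
  rewrite (_ : delta_mx 0 i = row (axis i) M) ?row_sub //.
  apply/rowP => j; rewrite !mxE eqxx /=.
  have := cpts_axis T b i j; rewrite mxE => ->.
  by rewrite [j == i]eq_sym; case: eqP => // _; rewrite /edge (negPf iT).
rewrite mxE; have eT : ((edge T i)%:Z)%:~R = 0 :> 'F_2 by rewrite /edge iT -pmulrn.
elim/ord_axisP: k => [|j|]; first by rewrite cpts0 mxE.
  by rewrite cpts_axis; case: eqP => [->|].
by rewrite cpts_max rmorphM /= eT mul0r.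
Qed.

(** Two equal points would give a relation supported on two indices, but [relc] is nonzero at the
    origin, at [w] and at an axis point. *)
Lemma cpts_inj : (exists i, b i != 0) -> injective p_.
Proof.
case=> i0 bi0 k l kl; apply/eqP/negPn/negP => nkl.
pose lam (j : 'I_n.+2) : R := (j == k)%:R - (j == l)%:R.
have sum_pick (V : lmodType R) (v : 'I_n.+2 -> V) h : \sum_j (j == h)%:R *: v j = v h.
  rewrite (bigD1 h) //= big1 ?addr0 ?eqxx ?scale1r //.
  by move=> j /negPf ->; rewrite scale0r.
have l0 : \sum_j lam j = 0.
  have one (x : 'I_n.+2) : \sum_j (j == x)%:R = 1 :> R.
    by rewrite (bigD1 x) //= eqxx big1 ?addr0 // => j /negPf->.
  by rewrite /lam sumrB !one subrr.
have lp : \sum_j lam j *: ptR p_ j = 0.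
  under eq_bigr => j _ do rewrite scalerBl.
  by rewrite sumrB !sum_pick /ptR kl subrr.
have lE := dependency l0 lp.
have lmax : lam ord_max != 0.
  apply/negP => /eqP lm; have := lE k; rewrite lm oppr0 mul0r /lam eqxx (negPf nkl) subr0.
  by move/eqP; rewrite oner_eq0.
have ne j : relc b j != 0 -> (j == k) || (j == l).
  move=> rj; apply/negPn/negP; rewrite negb_or => /andP[/negPf jk /negPf jl].
  have := lE j; rewrite {1}/lam jk jl subrr => /esym/eqP.
  by rewrite mulf_eq0 oppr_eq0 (negPf lmax) intr_eq0 (negPf rj).
have n0 := ne ord0 relc0_neq0.
have nm : (ord_max == k) || (ord_max == l) by apply: ne; rewrite relc_max.
have na : (axis i0 == k) || (axis i0 == l) by apply: ne; rewrite relc_axis.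
have d1 := axis_neq0 i0; have d2 := axis_neqmax i0; have d3 := max_neq0 n.
move: n0 nm na d1 d2 d3.
do 3 (move=> /orP[/eqP->|/eqP->]); rewrite ?eqxx //.
all: by move=> *.
Qed.
End Circuit.

(** * The relation for the chosen exponents *)

Section Exponents.
Variables (n s r : nat).
Hypothesis srn : (s + r <= n)%N.

Lemma sideexp_neq0 i : sideexp s i != 0.
Proof. by rewrite /sideexp; case: ifP => _; rewrite ?oppr_eq0 mulf_neq0 ?signr_eq0. Qed.

Lemma cexp_neq0 (i : 'I_n) : (cexp s r i != 0) = (i < s + r)%N.
Proof. by rewrite /cexp; case: ifP; rewrite ?sideexp_neq0 ?eqxx. Qed.

Lemma cexp_le2 (i : 'I_n) : `|cexp s r i| <= 2.
Proof.
rewrite /cexp /sideexp; case: ifP => _; last by rewrite normr0.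
by case: ifP => _; rewrite ?normrN normrM normr_sign.
Qed.

Lemma big_cexp (M : nmodType) (h : int -> M) : h 0 = 0 ->
  \sum_(i < n) h (cexp s r i) =
  \sum_(i < s) h (2 * (-1) ^+ i) + h (- (2 * (-1) ^+ s)) *+ r.
Proof.
move=> h0; transitivity (\sum_(i < s + r) h (sideexp s i)).
  rewrite (big_ord_widen n (fun i => h (sideexp s i)) srn) [RHS]big_mkcond.
  by apply: eq_bigr => i _; rewrite /cexp; case: ifP.
rewrite big_split_ord /=; congr (_ + _).
  by apply: eq_bigr => i _; rewrite /sideexp ltn_ord.
under eq_bigr => i _ do rewrite /sideexp ltnNge leq_addr /=.
by rewrite sumr_const card_ord.
Qed.

Lemma relc0_cexp :
  relc (cexp s r : 'I_n -> int) ord0 = (-1) ^+ s * (1 + 2 * r%:Z).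
Proof.
have alt k : \sum_(i < k) (2 * (-1) ^+ i) = 1 - (-1) ^+ k :> int.
  elim: k => [|k IH]; first by rewrite big_ord0 expr0 subrr.
  by rewrite big_ord_recr /= IH exprS; ring.
rewrite relc0 (@big_cexp _ id) //= alt -mulr_natr natz; ring.
Qed.

(** For even [s] the positive part consists of [s / 2] twos and [1 + 2 r] at the origin; for odd
    [s], of [(s + 1) / 2 + r] twos. *)
Lemma vol_cexp : vol (cexp s r : 'I_n -> int) = (s + 2 * r).+1.
Proof.
have alt k : (\sum_(i < k) (if (0 <= 2 * (-1) ^+ i :> int)%R then 2 else 0) = k + odd k)%N.
  elim: k => [|k IH]; first by rewrite big_ord0.
  rewrite big_ord_recr /= IH -signr_odd; case: (odd k) => /=; lia.
pose h (z : int) : nat := if 0 <= z then absz z else 0%N.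
rewrite /vol big_axis /= {1 3}/posrel relc0_cexp relc_max.
have -> : (\sum_(i < n) posrel (cexp s r : 'I_n -> int) (axis i) =
    \sum_(i < n) h (cexp s r i))%N.
  by apply: eq_bigr => i _; rewrite /posrel relc_axis.
rewrite (@big_cexp nat h) //.
have -> : \sum_(i < s) h (2 * (-1) ^+ i) = (s + odd s)%N.
  rewrite -alt; apply: eq_bigr => i _; rewrite /h -signr_odd.
  by case: (odd i).
have natM (a k : nat) : a *+ k = (a * k)%N.
  by elim: k => [|k IH]; rewrite ?mulr0n ?muln0 // mulrS mulnS IH.
rewrite -[(-1) ^+ s]signr_odd /h; case: (odd s) => /=.
all: rewrite ?expr0 ?expr1 natM /=; lia.
Qed.
End Exponents.

Lemma card_ord_range n u k : (u + k <= n)%N ->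
  #|[set i : 'I_n | u <= i < u + k]%N| = k.
Proof.
move=> ukn; have lt (j : 'I_k) : (u + j < n)%N by rewrite (leq_trans _ ukn) // ltn_add2l.
pose f j := Ordinal (lt j).
have f_inj : injective f by move=> i j /(congr1 val)/= /addnI /val_inj.
rewrite -[RHS](card_ord k) -cardsT -(card_imset _ f_inj); apply: eq_card => i.
rewrite inE; apply/andP/imsetP => [[ui iuk]|[j _ ->]] /=.
  have ik : (i - u < k)%N by lia.
  by exists (Ordinal ik) => //; apply: val_inj; rewrite /= subnKC.
by rewrite leq_addr ltn_add2l.
Qed.

Theorem theorem3p7 (n m Rk : nat) :
  (1 <= m <= n)%N -> (Rk <= n)%N ->
  exists pts : 'I_(n.+2) -> 'rV[int]_n,
    [/\ is_circuit pts, circuit_m pts m, rank_mod2 pts = Rk &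
      exists c : 'I_n -> 'I_(n.+2) -> R,
        [/\ supported_on c, generic_system pts c &
          exists N : nat,
            [/\ has_card (real_solution pts c) N,
                (Rk <= m)%N -> N = (2 ^ (n - Rk) * (m + Rk + 1))%N &
                (m <= Rk)%N -> N = (2 ^ (n - Rk) * (2 * m + 1))%N]]].
Proof.
move=> /andP[m1 mn] Rkn.
pose s := (m - Rk)%N; pose r := minn m Rk.
have srm : (s + r)%N = m by rewrite /s /r; lia.
have srn : (s + r <= n)%N by rewrite srm.
(* The indices with [a_i = 1] include all those with [t i < 0], so only positive numbers need square
   roots. *)
pose T := [set i : 'I_n | ~~ (s <= i < s + Rk)%N].
pose b : 'I_n -> int := cexp s r.
have card_nT : #|~: T| = Rk.
  rewrite -[RHS](@card_ord_range n s) ?/s; last by lia.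
  by apply: eq_card => i; rewrite !inE negbK.
have cardT : #|T| = (n - Rk)%N.
  by rewrite -card_nT -[n in (n - _)%N]card_ord -(cardsC T) addnK.
have b0 i : (b i != 0) = (i < m)%N by rewrite cexp_neq0 srm.
have r0 : relc b ord0 != 0 by rewrite relc0_cexp // mulf_neq0 ?signr_eq0 //; lia.
have volE : vol b = (s + 2 * r).+1 by apply: vol_cexp.
have [t [rts [tneg tn0 [urts szr] rpos [c c0 rE]]]] := sides_roots R s r.
have Tpos (i : 'I_n) : i \in T -> 0 < t i.
  rewrite inE => iT; rewrite lt_def tn0 /= leNgt -tneg.
  by apply: contra iT => /andP[-> /=]; rewrite /r; lia.
have card_sol (F : fieldType) (phi : {rmorphism R -> F}) g : 0 < g ->
    has_card (fun z : 'rV[F]_n => (forall i, z ord0 i != 0) /\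
      forall j, eval_lpoly (cpts T b) phi (csys g t j) z = 0)
    (2 ^ (n - Rk) * (s + 2 * r).+1).
  move=> g0; eexists; split.
  - exact: (solutions_uniq srn tneg Tpos rpos c0 rE phi urts).
  - by rewrite size_solutions szr cardT mulnC.
  move=> z; rewrite -(solutionsP srn tneg Tpos rpos c0 rE).
  have cs := csys_solve T b phi t z g0.
  by split=> -[z0 /cs h].
(* [g] exceeds every [|t j / \sum_i t i|], so the coefficient of [w] cannot vanish; if the sum is
   zero, that coefficient is [- t j]. *)
pose g : R := 1 + \sum_(j < n) `|t j / \sum_(i < n) t i|.
have g0 : 0 < g by rewrite ltr_wpDr // sumr_ge0.
exists (cpts T b); split.
- split; last first.
    rewrite aff_dim_cpts => [|//|i _]; rewrite ?inE //.
    by rewrite -[RHS]card_ord; apply: eq_card => i; rewrite !inE.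
  by apply: cpts_inj => //; exists (Ordinal (leq_trans m1 mn)); rewrite b0.
- split; first by exists (relsupp b); apply/minimal_aff_depP.
  move=> S /minimal_aff_depP ->; rewrite // aff_dim_cpts ?inE //; last first.
    by move=> i; rewrite inE relc_axis.
  rewrite -[RHS](@card_ord_range n 0 m) ?add0n //; apply: eq_card => i.
  by rewrite !inE relc_axis b0.
- by rewrite rank_mod2_cpts.
exists (csys g t); split.
- move=> j; apply: ord_axisP => [|i|];
    rewrite /csys ?eqxx ?axis_neq0 ?axis_neqmax ?max_neq0.
  + by rewrite oppr_eq0 gt_eqF // ltr_wpDr // mulr_ge0 // ltW.
  + by rewrite gt_eqF // ltr_wpDr.
  rewrite oppr_eq0; have [->|st0] := eqVneq (\sum_(i < n) t i) 0.
    by rewrite mulr0 addr0.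
  have lt_g : `|t j / \sum_(i < n) t i| < g.
    by rewrite /g [X in _ < 1 + X](bigD1 j) //= addrCA ltrDl ltr_wpDr // sumr_ge0.
  apply/negP; rewrite addr_eq0 -mulNr => /eqP h.
  by move: lt_g; rewrite h mulfK // normrN gtr0_norm // ltxx.
(* Genericity: [vol b] equals the number of roots, so the complex count is the volume. *)
- exists (2 ^ (n - Rk) * (s + 2 * r).+1)%N; split.
    exact: (card_sol _ (real_complex R)).
  rewrite -volE -cardT; apply: volume_limit; rewrite ?volE //.
    by move=> i; apply: cexp_le2.
  by move: mn m1 srn; rewrite /r /s; lia.
- exists (2 ^ (n - Rk) * (s + 2 * r).+1)%N; split.
  + exact: (card_sol _ idfun).
  (* [s + 2 * r] is [m + Rk] here and [2 * m] in the next case. *)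
  + by move=> Rm; congr (_ * _)%N; rewrite /s /r; lia.
  + by move=> Rm; congr (_ * _)%N; rewrite /s /r; lia.
Qed.
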